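(* Let $\kappa>0$ and let $X$ be a complete CAT$(\kappa)$ space with metric $d$ and $\mathrm{diam}(X)<\pi/(2\sqrt\kappa)$. Let $r\ge1$ be an integer and let $C_1,\ldots,C_r\subseteq X$ be nonempty closed and convex sets such that $\bigcap_{i=1}^rC_i\neq\emptyset$ and there exists $i\in\{1,\ldots,r\}$ such that $C_i$ is locally compact. Let $(\varepsilon_n)_{n\in\mathbb{N}}$ be nonnegative reals with $\sum_{n=0}^\infty\varepsilon_n<\infty$, let $x_0\in X$ be any starting point, and let $(x_n)$ be any sequence in $X$ starting at $x_0$ with $$d(x_{n+1},P_{C_{\overline{n}}}x_n)\le\varepsilon_n\quad\text{for each } n\in\mathbb{N},$$ where $\overline{n}=(n\bmod r)+1$. Then $(x_n)$ converges to some point in $\bigcap_{i=1}^rC_i$.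
   Context: $\mathbb{N}=\{0,1,2,\ldots\}$. CAT$(\kappa)$ spaces are geodesic spaces of curvature bounded above by $\kappa$ in the usual sense of comparison triangles in the model plane of constant curvature $\kappa$. A subset is convex iff it contains all geodesic segments joining any two of its points. For $C$ nonempty closed convex in such a complete space $X$, the metric projection $P_C(x)$ is the unique point $c\in C$ with $d(x,c)=\inf_{c'\in C}d(x,c')$ (well-defined under the stated diameter bound). *)

(* Defs.v *)
From HB Require Import structures.
From mathcomp Require Import all_boot all_order all_algebra.
From mathcomp Require Import all_classical all_reals all_analysis.

Set Implicit Arguments.
Unset Strict Implicit.
Unset Printing Implicit Defensive.

Import Order.TTheory GRing.Theory Num.Theory.
Import numFieldNormedType.Exports.

Local Open Scope classical_set_scope.
Local Open Scope ring_scope.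

(* Geodesics are defined for a bare distance function so that the same notion
   serves for a metricType and for the model plane below. *)
Section geodesics.
Context {R : realType} {T : Type}.
Variable dist : T -> T -> R.

(* Only the values of c on [0, l] matter; they force l = dist x y. *)
Definition geodesic_path (x y : T) (l : R) (c : R -> T) : Prop :=
  [/\ 0 <= l, c 0 = x, c l = y &
      forall s t, s \in `[0, l] -> t \in `[0, l] ->
        dist (c s) (c t) = `|s - t|].

Definition geodesic_segment (x y : T) (S : set T) : Prop :=
  exists l c, geodesic_path x y l c /\ S = c @` `[0, l].

Definition geodesic_space : Prop :=
  forall x y, exists S, geodesic_segment x y S.

(* ordS is the cyclic successor on 'I_3: S i is the side from v i to v (i+1). *)
Definition geodesic_triangle (v : 'I_3 -> T) (S : 'I_3 -> set T) : Prop :=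
  forall i, geodesic_segment (v i) (v (ordS i)) (S i).

Definition perimeter (v : 'I_3 -> T) : R := \sum_i dist (v i) (v (ordS i)).

Definition geodesically_convex (C : set T) : Prop :=
  forall x y S, C x -> C y -> geodesic_segment x y S -> S `<=` C.

End geodesics.

(* The model plane of constant curvature k > 0: the unit sphere of R^3 with its
   angular metric divided by sqrt k. *)
Definition inner3 {R : realType} (u v : 'rV[R]_3) : R := \sum_i u 0 i * v 0 i.

Definition sphere2 (R : realType) : Type := {u : 'rV[R]_3 | inner3 u u = 1}.

Definition model_dist {R : realType} (k : R) (u v : sphere2 R) : R :=
  acos (inner3 (sval u) (sval v)) / Num.sqrt k.

(* CAT(k) for k > 0. A comparison triangle exists, and is unique up to isometry,
   for every triangle of perimeter < 2 pi / sqrt k; its sides are then shorter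
   than pi / sqrt k, so that x' and y' are the comparison points of x and y. *)
Definition CAT {R : realType} (k : R) (X : metricType R) : Prop :=
  geodesic_space (@mdist R X) /\
  forall (v : 'I_3 -> X) (S : 'I_3 -> set X)
         (v' : 'I_3 -> sphere2 R) (S' : 'I_3 -> set (sphere2 R)),
    geodesic_triangle (@mdist R X) v S ->
    perimeter (@mdist R X) v < 2 * (pi / Num.sqrt k) ->
    geodesic_triangle (model_dist k) v' S' ->
    (forall i, model_dist k (v' i) (v' (ordS i)) = mdist (v i) (v (ordS i))) ->
    forall (i j : 'I_3) (x y : X) (x' y' : sphere2 R),
      S i x -> S j y -> S' i x' -> S' j y' ->
      model_dist k (v' i) x' = mdist (v i) x ->
      model_dist k (v' j) y' = mdist (v j) y ->
      mdist x y <= model_dist k x' y'.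

(* The library's completeType is pointed and not joined with metricType. *)
Definition complete_metric {R : realType} (X : metricType R) : Prop :=
  forall u : nat -> X, cauchy (u @ \oo) -> exists l : X, u @ \oo --> l.

(* Valued in \bar R, since the real-valued sup of an unbounded set is 0. *)
Definition diam {R : realType} (X : metricType R) : \bar R :=
  ereal_sup (range (fun p : X * X => (mdist p.1 p.2)%:E)).

(* The default value x is irrelevant whenever a nearest point exists. *)
Definition metric_projection {R : realType} {X : metricType R}
    (C : set X) (x : X) : X :=
  xget x [set c | C c /\ mdist x c = inf [set mdist x c' | c' in C]].

(* Main.v *)
(* Comparison with the sphere gives, for [m] at distance [s] from [a] on a
   geodesic [a, b] of length [l] (curvature 1), the spherical Stewart inequality
     cos d(x,a) sin (l - s) + cos d(x,b) sin s <= cos d(x,m) sin l.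
   At the midpoint it makes minimising sequences Cauchy, so projections onto
   closed convex sets exist; as [s] tends to 0 along the geodesic from the
   projection z of x to a point p of C it becomes
     cos d(x,p) <= cos d(x,z) cos d(z,p).
   Hence for p in the intersection the distances d(x_n,p) decrease up to summable
   errors and converge, and the gap in the last inequality forces x_n to approach
   every C_i. It remains to find one cluster point of x_n: it lies in the
   intersection, so its distance to x_n converges, necessarily to 0.
   Let C_i be locally compact and y_n the projection of x_n onto C_i. Along an
   ultrafilter refining n -> oo, the set of t in [0,1] at which the points c_n(t)
   of the geodesics from p to y_n converge contains 0, is closed by completeness
   and open by local compactness; at t = 1 this is the convergence of y_n. *)

Require Import Defs.
From HB Require Import structures.
From mathcomp Require Import all_boot all_order all_algebra.
From mathcomp Require Import all_classical all_reals all_analysis.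
From mathcomp Require Import ring lra.

Set Implicit Arguments.
Unset Strict Implicit.
Unset Printing Implicit Defensive.

Import Order.TTheory GRing.Theory Num.Theory.
Import numFieldNormedType.Exports.
Import metricType_numDomainType.

Local Open Scope classical_set_scope.
Local Open Scope ring_scope.

(** * The model sphere *)

Section sphere.
Context {R : realType}.
Implicit Types (u v w z : 'rV[R]_3) (a b c d s t : R).

Lemma inner3C u v : inner3 u v = inner3 v u.
Proof. by apply: eq_bigr => i _; rewrite mulrC. Qed.

Lemma inner3_comb a b c d u v w z :
  inner3 (a *: u + b *: v) (c *: w + d *: z) =
  a * c * inner3 u w + a * d * inner3 u z +
  (b * c * inner3 v w + b * d * inner3 v z).
Proof. by rewrite /inner3 !big_ord_recl !big_ord0 !mxE; ring. Qed.

Lemma inner3_combl a b u v z :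
  inner3 (a *: u + b *: v) z = a * inner3 u z + b * inner3 v z.
Proof. by rewrite /inner3 !big_ord_recl !big_ord0 !mxE; ring. Qed.

Lemma inner3_eq0 u : inner3 u u = 0 -> u = 0.
Proof.
move=> /eqP; rewrite psumr_eq0 => [/allP u0|i _]; last by rewrite -expr2 sqr_ge0.
apply/rowP => i; rewrite mxE; apply/eqP.
by have := u0 i (mem_index_enum i); rewrite mulf_eq0 orbb.
Qed.

Lemma sphere2_inj (u v : sphere2 R) : sval u = sval v -> u = v.
Proof. by move: u v => [u pu] [v pv] /= uv; exact: eq_exist. Qed.

Lemma sphere2_eq (u v : sphere2 R) : inner3 (sval u) (sval v) = 1 -> u = v.
Proof.
move=> uv; apply: sphere2_inj; apply/eqP; rewrite -subr_eq0; apply/eqP.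
apply: inner3_eq0.
have -> : sval u - sval v = 1 *: sval u + -1 *: sval v.
  by rewrite scale1r scaleN1r.
by rewrite inner3_comb (svalP u) (svalP v) (inner3C (sval v)) uv; ring.
Qed.

Lemma model_dist_cos (k a : R) (u v : sphere2 R) :
  0 < k -> 0 <= Num.sqrt k * a <= pi ->
  inner3 (sval u) (sval v) = cos (Num.sqrt k * a) -> model_dist k u v = a.
Proof.
move=> k0 /andP[a0 api] uv; rewrite /model_dist uv cosK ?in_itv/= ?a0//.
by rewrite mulrC mulKf// gt_eqF// sqrtr_gt0.
Qed.

(** Both bounds come from expanding the squared norms of [u + v] and [u - v]. *)
Lemma inner3_le1 (u v : sphere2 R) : -1 <= inner3 (sval u) (sval v) <= 1.
Proof.
have pos (w : 'rV[R]_3) : 0 <= inner3 w w.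
  by apply: sumr_ge0 => i _; rewrite -expr2 sqr_ge0.
have := pos (1 *: sval u + 1 *: sval v); have := pos (1 *: sval u + -1 *: sval v).
rewrite !inner3_comb (svalP u) (svalP v) (inner3C (sval v)); lra.
Qed.

Lemma cos_model_dist (k : R) (u v : sphere2 R) : 0 < k ->
  cos (Num.sqrt k * model_dist k u v) = inner3 (sval u) (sval v).
Proof.
move=> k0; rewrite /model_dist mulrC divfK ?gt_eqF ?sqrtr_gt0//.
by rewrite acosK// in_itv/= inner3_le1.
Qed.

Definition great_circle u w s := cos s *: u + sin s *: w.

Lemma great_circleE u w s t :
  inner3 u u = 1 -> inner3 w w = 1 -> inner3 u w = 0 ->
  inner3 (great_circle u w s) (great_circle u w t) = cos (s - t).
Proof.
move=> uu ww uw; rewrite inner3_comb uu ww (inner3C w) uw cosD cosN sinN; ring.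
Qed.

(** The linear formula for [c s] is what later turns the comparison inequality into the Stewart
    inequality; multiplied through by [sin (Num.sqrt k * l)], it stays true in the degenerate case
    [l = 0]. *)
Lemma sphere_geodesic (k l : R) (u v : sphere2 R) :
  0 < k -> 0 <= Num.sqrt k * l < pi ->
  inner3 (sval u) (sval v) = cos (Num.sqrt k * l) ->
  exists c : R -> sphere2 R, geodesic_path (model_dist k) u v l c /\
    forall s z, sin (Num.sqrt k * l) * inner3 (sval (c s)) z =
      sin (Num.sqrt k * (l - s)) * inner3 (sval u) z +
      sin (Num.sqrt k * s) * inner3 (sval v) z.
Proof.
set q := Num.sqrt k => k0 /andP[l0 lpi] uv.
have q0 : 0 < q by rewrite sqrtr_gt0.
have l_ge0 : 0 <= l by rewrite pmulr_rge0 in l0.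
have [ql0|ql_neq0] := eqVneq (q * l) 0.
  have l00 : l = 0 by apply/eqP; move/eqP: ql0; rewrite mulf_eq0 gt_eqF.
  have {uv}uv : u = v by apply: sphere2_eq; rewrite uv ql0 cos0.
  exists (fun=> u); split; last first.
    move=> s z; rewrite ql0 l00 sub0r mulrN sinN sin0 -uv; ring.
  split => // s t; rewrite l00 !in_itv/= => s0 t0.
  have -> : s = t by lra.
  rewrite subrr normr0; apply: model_dist_cos; rewrite // mulr0.
    by rewrite lexx pi_ge0.
  by rewrite cos0 (svalP u).
have sl0 : 0 < sin (q * l) 
  by rewrite sin_gt0_pi// lpi lt_neqAle eq_sym ql_neq0 l0.
have sl_neq0 : sin (q * l) != 0 by rewrite gt_eqF.
(* Gram-Schmidt: [w] is the unit vector orthogonal to [u] with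
   [v = cos (q * l) u + sin (q * l) w]. *)
pose w := (sin (q * l))^-1 *: sval v + (- (cos (q * l) / sin (q * l))) *: sval u.
have cs := cos2Dsin2 (q * l).
have uw : inner3 (sval u) w = 0.
  rewrite inner3C /w inner3_combl (inner3C (sval v)) uv (svalP u); field.
  exact: sl_neq0.
have ww : inner3 w w = 1.
  rewrite /w inner3_comb (inner3C (sval v) (sval u)) uv (svalP u) (svalP v).
  transitivity ((1 - cos (q * l) ^+ 2) / sin (q * l) ^+ 2); first by field.
  have -> : 1 - cos (q * l) ^+ 2 = sin (q * l) ^+ 2 by rewrite -cs; ring.
  by rewrite divff// expf_neq0.
have unit s : inner3 (great_circle (sval u) w (q * s))
                     (great_circle (sval u) w (q * s)) = 1.
  by rewrite great_circleE// ?(svalP u)// subrr cos0.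
exists (fun s => exist (fun x : 'rV[R]_3 => inner3 x x = 1) _ (unit s)); split; last first.
  move=> s z /=; rewrite inner3_combl /w inner3_combl mulrBr sinB; field.
  exact: sl_neq0.
split => //.
- apply: sphere2_inj => /=.
  by rewrite /great_circle mulr0 cos0 sin0 scale1r scale0r addr0.
- apply: sphere2_inj => /=; rewrite /great_circle /w scalerDr !scalerA.
  rewrite divff// scale1r addrCA -scalerDl mulrN mulrCA divff// mulr1 subrr.
  by rewrite scale0r addr0.
- move=> s t; rewrite !in_itv/= => /andP[s0 sl] /andP[t0 tl].
  have dl : `|s - t| <= l by rewrite ler_norml; lra.
  apply: model_dist_cos => //.
    rewrite mulr_ge0//= ?ltW// (le_lt_trans _ lpi)// ler_wpM2l// ltW//.
  rewrite /= great_circleE// ?(svalP u)// -mulrBr.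
  by case: (ger0P (s - t)) => // _; rewrite mulrN cosN.
Qed.

(** Put [u] on the first axis, [v] in the plane of the first two, and [w = (cos A, y, z)]. The
    product with [v] forces [y], and the triangle inequalities leave room for a real [z]. *)
Lemma comparison_triangle (A B l : R) :
  0 <= A <= pi / 2 -> 0 <= B <= pi / 2 -> 0 < l <= pi / 2 ->
  A <= l + B -> B <= A + l -> l <= A + B ->
  exists u v w : sphere2 R,
    [/\ inner3 (sval u) (sval v) = cos l, inner3 (sval u) (sval w) = cos A
      & inner3 (sval v) (sval w) = cos B].
Proof.
move=> /andP[A0 A1] /andP[B0 B1] /andP[l0 l1] AlB BAl lAB.
have pi0 := pi_gt0 R.
have sl0 : sin l != 0 by rewrite gt_eqF// sin_gt0_pi// l0/=; lra.
have sl := cos2Dsin2 l; have sA := cos2Dsin2 A.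
pose y := (cos B - cos A * cos l) / sin l.
have yE : y * sin l = cos B - cos A * cos l by rewrite divfK.
have cosAl : cos B <= cos (A - l).
  have -> : cos (A - l) = cos `|A - l|.
    by case: (ger0P (A - l)) => // _; rewrite cosN.
  have nAl : `|A - l| <= B by rewrite ler_norml; lra.
  have := normr_ge0 (A - l); set N := `|A - l| in nAl *.
  by move=> N0; rewrite leNgt ltr_cos ?in_itv/= -?leNgt//; lra.
have cosAl' : cos (A + l) <= cos B.
  by rewrite leNgt ltr_cos ?in_itv/= -?leNgt//; lra.
have hy : 0 <= 1 - cos A ^+ 2 - y ^+ 2.
  (* This is a difference of squares, with factors [cos (A - l) - cos B] and
     [cos B - cos (A + l)]. *)
  have : 0 <= sin l ^+ 2 * (1 - cos A ^+ 2 - y ^+ 2).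
    have -> : sin l ^+ 2 * (1 - cos A ^+ 2 - y ^+ 2) =
        (sin l * sin A) ^+ 2 - (y * sin l) ^+ 2.
      have -> : 1 - cos A ^+ 2 = sin A ^+ 2 by rewrite -sA; ring.
      ring.
    rewrite yE subr_sqr mulr_ge0//.
      by move: cosAl; rewrite cosB; lra.
    by move: cosAl'; rewrite cosD; lra.
  by rewrite pmulr_rge0// exprn_even_gt0.
pose vec (a b c : R) : 'rV[R]_3 := \row_i nth 0 [:: a; b; c] i.
have vecE a b c a' b' c' :
    inner3 (vec a b c) (vec a' b' c') = a * a' + b * b' + c * c'.
  rewrite /inner3 !big_ord_recl big_ord0 !mxE /= addr0; ring.
have hu : inner3 (vec 1 0 0) (vec 1 0 0) = 1 by rewrite vecE; ring.
have hv : inner3 (vec (cos l) (sin l) 0) (vec (cos l) (sin l) 0) = 1.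
  by rewrite vecE -sl; ring.
pose z := Num.sqrt (1 - cos A ^+ 2 - y ^+ 2).
have hw : inner3 (vec (cos A) y z) (vec (cos A) y z) = 1.
  by rewrite vecE -!expr2 sqr_sqrtr//; ring.
pose pt x (hx : inner3 x x = 1) : sphere2 R := exist _ x hx.
exists (pt _ hu), (pt _ hv), (pt _ hw) => /=.
split; rewrite vecE; [ring|ring|].
by rewrite mulrC [sin l * y]mulrC yE; ring.
Qed.

End sphere.

(** * Comparison and nearest points *)

Lemma geodesic_path_length (R : realType) (X : metricType R) (x y : X) l c :
  geodesic_path (@mdist R X) x y l c -> l = mdist x y.
Proof.
move=> [l0 <- <- /(_ 0 l)]; rewrite !in_itv/= !lexx l0 => /(_ isT isT) ->.
by rewrite sub0r normrN ger0_norm.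
Qed.

Lemma cos_lipschitz (R : realType) (a b : R) : a <= b -> cos a - cos b <= b - a.
Proof.
move=> ab; have [c _ E] : exists2 c, c \in `[a, b] &
    cos b - cos a = - sin c * (b - a).
  apply: MVT_segment => //; apply: continuous_subspaceT => z.
  exact: continuous_cos.
rewrite -opprB E mulNr opprK ler_piMl ?subr_ge0//; exact: sin_le1.
Qed.

Section CAT.
Context {R : realType} {X : metricType R} (k : R).
Hypotheses (k_gt0 : 0 < k) (X_CAT : CAT k X).
Hypothesis X_small : forall x y : X, Num.sqrt k * mdist x y < pi / 2.

Local Notation ang x y := (Num.sqrt k * mdist x y).

Let sqrtk_gt0 : 0 < Num.sqrt k. Proof. by rewrite sqrtr_gt0. Qed.

Lemma ang_ge0 (x y : X) : 0 <= ang x y.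
Proof. by rewrite mulr_ge0 ?mdist_ge0// ltW. Qed.

Lemma ang_itv (x y : X) : ang x y \in `[0, pi].
Proof.
rewrite in_itv/= ang_ge0/=; have := X_small x y; have := pi_ge0 R; lra.
Qed.

Lemma cos_ang_gt0 (x y : X) : 0 < cos (ang x y).
Proof.
by apply: cos_gt0_pihalf; rewrite X_small andbT (lt_le_trans _ (ang_ge0 _ _))//
  oppr_lt0 divr_gt0// pi_gt0.
Qed.

Lemma le_cos_ang (x y x' y' : X) :
  (cos (ang x y) <= cos (ang x' y')) = (mdist x' y' <= mdist x y).
Proof. by rewrite leNgt ltr_cos ?ang_itv// -leNgt ler_pM2l. Qed.

(* In the comparison triangle this is an equality: the point at distance [s] on
   the great circle from [u] to [v] is
   [(sin (l - s) u + sin s v) / sin l], in arc length units. *)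
Lemma CAT_stewart (x a b : X) l c s :
  geodesic_path (@mdist R X) a b l c -> 0 <= s <= l ->
  cos (ang x a) * sin (Num.sqrt k * (l - s)) +
  cos (ang x b) * sin (Num.sqrt k * s) <=
  cos (ang x (c s)) * sin (Num.sqrt k * l).
Proof.
set q := Num.sqrt k => cG /andP[s0 sl].
have lE := geodesic_path_length cG.
have [l00|l_neq0] := eqVneq l 0.
  have -> : s = 0 by rewrite l00 in sl; lra.
  by rewrite l00 subr0 mulr0 sin0 !mulr0 addr0.
have l_gt0 : 0 < l by rewrite lt_neqAle eq_sym l_neq0 lE mdist_ge0.
have ql : 0 < q * l < pi.
  rewrite mulr_gt0//= lE; have := X_small a b; have := pi_gt0 R; rewrite -/q; lra.
have [u [v [w [uv uw vw]]]] :
    exists u v w : sphere2 R,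
    [/\ inner3 (sval u) (sval v) = cos (q * l),
        inner3 (sval u) (sval w) = cos (q * mdist x a)
      & inner3 (sval v) (sval w) = cos (q * mdist x b)].
  have tri (y z t : X) : q * mdist y z <= q * mdist y t + q * mdist t z.
    by rewrite -mulrDr ler_pM2l// metric_triangle.
  apply: comparison_triangle.
  - by rewrite ang_ge0 ltW// X_small.
  - by rewrite ang_ge0 ltW// X_small.
  - by rewrite mulr_gt0//= lE ltW// X_small.
  - by rewrite addrC lE (metric_sym a b) tri.
  - by rewrite lE tri.
  - by rewrite lE (metric_sym x a) tri.
have [geo cmp] := X_CAT.
have [S1 S1G] := geo b x; have [S2 S2G] := geo x a.
have side (y z : sphere2 R) (y' z' : X) :
    inner3 (sval y) (sval z) = cos (ang y' z') ->
    exists S, geodesic_segment (model_dist k) y z S /\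
              model_dist k y z = mdist y' z'.
  move=> yz; have yz_itv : 0 <= q * mdist y' z' < pi.
    rewrite ang_ge0/=; have := X_small y' z'; have := pi_ge0 R; rewrite -/q; lra.
  have [c' [c'G _]] := sphere_geodesic k_gt0 yz_itv yz.
  exists (c' @` `[0, mdist y' z']); split; first by exists (mdist y' z'), c'.
  by apply: model_dist_cos => //; move: yz_itv => /andP[-> /ltW].
have [S1' [S1'G vwE]] : exists S, geodesic_segment (model_dist k) v w S /\
    model_dist k v w = mdist b x by apply: side; rewrite metric_sym.
have [S2' [S2'G wuE]] : exists S, geodesic_segment (model_dist k) w u S /\
    model_dist k w u = mdist x a by apply: side; rewrite inner3C.
have ql' : 0 <= q * l < pi by case/andP: ql => /ltW -> ->.
have [c' [c'G c'E]] := sphere_geodesic k_gt0 ql' uv.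
have uvE : model_dist k u v = mdist a b.
  by rewrite -lE; apply: model_dist_cos => //; case/andP: ql' => -> /ltW.
(* The triangle has vertices [a], [b], [x] in this order. The points compared are [c s] on side 0
   and [x], taken as the initial point of side 2. *)
have key : mdist (c s) x <= model_dist k (c' s) w.
  pose vX (i : 'I_3) := nth a [:: a; b; x] i.
  pose vS (i : 'I_3) := nth u [:: u; v; w] i.
  pose SX (i : 'I_3) := nth set0 [:: c @` `[0, l]; S1; S2] i.
  pose SS (i : 'I_3) := nth set0 [:: c' @` `[0, l]; S1'; S2'] i.
  have s_itv : s \in `[0, l] by rewrite in_itv/= s0.
  have o_itv : 0 \in `[0, l] by rewrite in_itv/= lexx ltW.
  apply: (cmp vX SX vS SS _ _ _ _ ord0 (@Ordinal 3 2 isT)).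
  - by case=> [[|[|[|//]]]] i_lt //=; exists l, c.
  - rewrite /perimeter !big_ord_recl big_ord0 /= /vX /=.
    (* Each side has angle below [pi / 2], so the perimeter is below [3 * pi / 2] in angle. *)
    rewrite mulrA ltr_pdivlMr// mulrC.
    have := X_small a b; have := X_small b x; have := X_small x a.
    have := pi_gt0 R; rewrite -/q; lra.
  - by case=> [[|[|[|//]]]] i_lt //=; exists l, c'.
  - by case=> [[|[|[|//]]]] i_lt.
  - by exists s.
  - by rewrite /SX/=; case: S2G => l2 [c2 [[l20 c20 _ _] ->]]; exists 0;
      rewrite //= in_itv/= lexx.
  - by exists s.
  - by rewrite /SS/=; case: S2'G => l2 [c2 [[l20 c20 _ _] ->]]; exists 0;
      rewrite //= in_itv/= lexx.
  - rewrite /vS /vX /=.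
    case: cG => _ c0 _ /(_ 0 s o_itv s_itv); rewrite c0 => ->.
    by case: c'G => _ c'0 _ /(_ 0 s o_itv s_itv); rewrite c'0 => ->.
  - rewrite /vS /vX /= mdistxx; apply: model_dist_cos => //.
      by rewrite mulr0 lexx pi_ge0.
    by rewrite mulr0 cos0 (svalP w).
have sql : 0 < sin (q * l) by apply: sin_gt0_pi.
have -> : cos (ang x a) * sin (q * (l - s)) + cos (ang x b) * sin (q * s) =
    cos (q * model_dist k (c' s) w) * sin (q * l).
  by rewrite cos_model_dist// mulrC (mulrC _ (sin (q * l))) c'E uw vw; ring.
rewrite ler_pM2r// leNgt ltr_cos ?ang_itv//.
  by rewrite -leNgt ler_pM2l// metric_sym.
rewrite in_itv/= /model_dist mulrC divfK ?gt_eqF//.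
by rewrite acos_ge0 ?acos_lepi// inner3_le1.
Qed.

(** Stewart at [s = l / 2]: by the double angle formula both sides carry the factor
    [sin (q * l / 2)], which cancels when [a] and [b] are distinct. *)
Lemma CAT_midpoint (x a b : X) c :
  geodesic_path (@mdist R X) a b (mdist a b) c ->
  cos (ang x a) + cos (ang x b) <=
  2 * cos (ang x (c (mdist a b / 2))) * cos (ang a b / 2).
Proof.
move=> cG; set l := mdist a b; set q := Num.sqrt k.
have [ab0|ab_neq0] := eqVneq (mdist a b) 0.
  have ab := mdist_positivity _ _ ab0; case: cG => _ c0 _ _.
  by rewrite /l ab0 mul0r mulr0 mul0r cos0 c0 -ab; lra.
have l0 : 0 < l by rewrite lt_neqAle eq_sym ab_neq0 mdist_ge0.
have := @CAT_stewart x a b l c (l / 2) cG.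
have -> : q * (l - l / 2) = q * l / 2 by field.
have -> : q * (l / 2) = q * l / 2 by field.
have -> : sin (q * l) = 2 * sin (q * l / 2) * cos (q * l / 2).
  have {1}-> : q * l = q * l / 2 + q * l / 2 by field.
  by rewrite sinD; ring.
rewrite -mulrDl.
have sl : 0 < sin (q * l / 2).
  apply: sin_gt0_pihalf; rewrite divr_gt0 ?mulr_gt0//=.
  by have := X_small a b; rewrite -/q -/l; have := pi_gt0 R; lra.
set C := cos (q * mdist x _); set s := sin _ in sl *; set d := cos (q * l / 2).
move=> H; rewrite -(ler_pM2r sl); apply: le_trans (H _) _; last by nra.
by apply/andP; split; lra.
Qed.

(** * Nearest points and the inequalities they satisfy *)

Lemma CAT_geodesic (x y : X) :
  exists c, geodesic_path (@mdist R X) x y (mdist x y) c.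
Proof.
have [S [l [c [cG _]]]] := X_CAT.1 x y.
by exists c; rewrite -(geodesic_path_length cG).
Qed.

(** Uniform convexity: if [a] and [b] were [e] apart, the midpoint inequality would put their
    midpoint, a point of [C], closer to [x] than [d]. *)
Lemma nearby_almost_nearest (C : set X) (x : X) (d e : R) :
  geodesically_convex (@mdist R X) C ->
  0 <= d -> Num.sqrt k * d < pi / 2 -> (forall y, C y -> d <= mdist x y) ->
  0 < e -> exists2 h, 0 < h & forall a b, C a -> C b ->
    mdist x a < d + h -> mdist x b < d + h -> mdist a b < e.
Proof.
set q := Num.sqrt k => C_convex d0 dpi d_lb e0.
have pi0 := pi_gt0 R.
have [qe|qe] := leP (pi / 2) (q * e).
  exists 1 => // a b _ _ _ _; rewrite -(@ltr_pM2l _ q)//.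
  exact: lt_le_trans (X_small a b) qe.
have qd0 : 0 <= q * d by rewrite mulr_ge0// ltW.
have qe0 : 0 < q * e by rewrite mulr_gt0.
have cd : 0 < cos (q * d) by apply: cos_gt0_pihalf; rewrite dpi andbT; lra.
have ce : cos (q * e / 2) < 1.
  by rewrite -[ltRHS]cos0 ltr_cos ?in_itv/=; lra.
(* The midpoint inequality will give [cos (q * d) * (1 - cos (q * e / 2)) < q * h]; this [h] makes
   the right side half of the left, a contradiction. *)
pose h := cos (q * d) * (1 - cos (q * e / 2)) / (2 * q).
exists h; first by rewrite /h divr_gt0 ?mulr_gt0 ?subr_gt0.
have qh : q * h = cos (q * d) * (1 - cos (q * e / 2)) / 2.
  by rewrite /h; field; rewrite gt_eqF.
move=> a b Ca Cb xa xb; rewrite ltNge; apply/negP => eab.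
have near y : C y -> mdist x y < d + h ->
    cos (q * d) - q * h < cos (q * mdist x y).
  move=> Cy xy.
  have dy : q * d <= q * mdist x y by rewrite ler_pM2l// d_lb.
  have := cos_lipschitz dy; move: xy; rewrite -(ltr_pM2l sqrtk_gt0) -/q mulrDr.
  lra.
have [c cG] := CAT_geodesic a b.
pose m := c (mdist a b / 2).
have Cm : C m.
  apply: (C_convex a b (c @` `[0, mdist a b])) => //.
    by exists (mdist a b), c.
  exists (mdist a b / 2) => //; rewrite /= in_itv/=.
  by have := mdist_ge0 a b; lra.
have xm : cos (q * mdist x m) <= cos (q * d).
  rewrite leNgt ltr_cos ?ang_itv// -?leNgt ?ler_pM2l ?d_lb//.
  by rewrite in_itv/=; lra.
have := CAT_midpoint x cG; rewrite -/m.
have cab : cos (q * mdist a b / 2) <= cos (q * e / 2).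
  have := X_small a b; rewrite -/q; set A := q * mdist a b => Api.
  have qeA : q * e <= A by rewrite ler_pM2l.
  by rewrite leNgt ltr_cos ?in_itv/= -?leNgt; lra.
rewrite -/q; have := near a Ca xa; have := near b Cb xb.
move: (cos (q * mdist x a)) (cos (q * mdist x b)) => A B.
have xm0 : 0 < cos (q * mdist x m) by exact: cos_ang_gt0.
have : cos (q * mdist x m) * cos (q * mdist a b / 2) <=
       cos (q * d) * cos (q * e / 2).
  apply: le_trans (_ : cos (q * mdist x m) * cos (q * e / 2) <= _).
    by rewrite ler_pM2l.
  rewrite ler_wpM2r//; apply: cos_ge0_pihalf; lra.
rewrite qh.
have : 0 < cos (q * d) * (1 - cos (q * e / 2)) by rewrite mulr_gt0// subr_gt0.
lra.
Qed.

Hypothesis X_complete : complete_metric X.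

(** Almost nearest points are close to each other, so a minimising sequence is Cauchy; its limit is
    in [C] and attains the infimum. *)
Lemma nearest_point_exists (C : set X) (x : X) :
  closed C -> geodesically_convex (@mdist R X) C -> C !=set0 ->
  exists c, C c /\ mdist x c = inf [set mdist x c' | c' in C].
Proof.
move=> C_closed C_convex [c0 Cc0]; set E := [set mdist x c' | c' in C].
have E_inf : has_inf E.
  split; first by exists (mdist x c0), c0.
  by exists 0 => _ [y _ <-]; exact: mdist_ge0.
have inf_le y : C y -> inf E <= mdist x y.
  by move=> Cy; apply: ge_inf; [case: E_inf|exists y].
have inf0 : 0 <= inf E.
  by apply: lb_le_inf; [case: E_inf|move=> _ [y _ <-]; exact: mdist_ge0].
have infpi : Num.sqrt k * inf E < pi / 2.
  by apply: le_lt_trans (X_small x c0); rewrite ler_pM2l// inf_le.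
have /choice[a aP] : forall n : nat, exists y,
    C y /\ mdist x y < inf E + n.+1%:R^-1.
  move=> n; have n0 : 0 < n.+1%:R^-1 :> R by rewrite invr_gt0.
  by have [_ [y Cy <-] ?] := inf_adherent n0 E_inf; exists y.
have a_near h : 0 < h -> \forall n \near \oo, mdist x (a n) < inf E + h.
  move=> h0; near=> n; apply: lt_le_trans (aP n).2 _; rewrite lerD2l ltW//.
  by near: n; exact: near_infty_natSinv_lt (PosNum h0).
have [l al] : exists l : X, a @ \oo --> l.
  apply: X_complete; apply: cauchy_exP => e e0.
  have [h h0 hP] := nearby_almost_nearest C_convex inf0 infpi inf_le e0.
  have [N _ NP] := a_near h h0.
  exists (a N); exists N => // n Nn; rewrite ballEmdist/=.
  by apply: hP; [exact: (aP N).1|exact: (aP n).1|apply: NP => /=|apply: NP].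
exists l; split.
  by apply: closed_cvg al => //; apply: nearW => n; exact: (aP n).1.
apply/eqP; rewrite eq_le inf_le ?andbT; last first.
  by apply: closed_cvg al => //; apply: nearW => n; exact: (aP n).1.
apply/ler_addgt0Pr => e e0.
have e2 : 0 < e / 2 by rewrite divr_gt0.
near \oo => n.
have xn : mdist x (a n) < inf E + e / 2 by near: n; exact: a_near.
have nl : mdist l (a n) < e / 2.
  by near: n; exact: cvgr_dist_lt.
have := metric_triangle x (a n) l; rewrite (metric_sym (a n)); lra.
Unshelve. all: by end_near. Qed.

Lemma metric_projectionP (C : set X) (x : X) :
  closed C -> geodesically_convex (@mdist R X) C -> C !=set0 ->
  C (metric_projection C x) /\
  forall y, C y -> mdist x (metric_projection C x) <= mdist x y.
Proof.
move=> C_closed C_convex C0.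
have [c cP] := nearest_point_exists x C_closed C_convex C0.
rewrite /metric_projection; case: xgetP => [y -> [Cy yE]|/(_ c)]; last by [].
split=> // z Cz; rewrite yE; apply: ge_inf; last by exists z.
by exists 0 => _ [t _ <-]; exact: mdist_ge0.
Qed.

(** Stewart on the geodesic from [z] to [p], whose points are no closer to [x] than [z] is. Dividing
    by [2 sin (q * s / 2)] leaves [A cos (q * s / 2) <= B cos (q * l - q * s / 2)]; the limit at
    [s = 0] is taken with an explicit error [e]. *)
Lemma nearest_point_pythagoras (C : set X) (x z p : X) :
  geodesically_convex (@mdist R X) C -> C z -> C p ->
  (forall y, C y -> mdist x z <= mdist x y) ->
  cos (ang x p) <= cos (ang x z) * cos (ang z p).
Proof.
set q := Num.sqrt k => C_convex Cz Cp z_near.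
have [zp0|zp_neq0] := eqVneq (mdist z p) 0.
  by rewrite zp0 (mdist_positivity _ _ zp0) mulr0 cos0 mulr1.
set l := mdist z p; have l0 : 0 < l by rewrite lt_neqAle eq_sym zp_neq0 mdist_ge0.
have [c cG] := CAT_geodesic z p.
apply/ler_addgt0Pr => e e0.
(* The bound [l] keeps [c s] on the geodesic; the bound [e / q] makes the final error [q * s] at
   most [e]. *)
pose s := Num.min l (e / q).
have s0 : 0 < s by rewrite lt_min l0 divr_gt0.
have sl : s <= l by rewrite ge_min lexx.
have sq : q * s <= e by rewrite mulrC -ler_pdivlMr// ge_min lexx orbT.
have Cs : C (c s).
  apply: (C_convex z p (c @` `[0, l])) => //; first by exists l, c.
  by exists s => //; rewrite /= in_itv/= sl ltW.
have sl' : 0 <= s <= l by rewrite sl ltW.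
have := CAT_stewart x cG sl'.
have : cos (q * mdist x (c s)) <= cos (q * mdist x z) by rewrite le_cos_ang z_near.
have xp0 : 0 < cos (q * mdist x p) by exact: cos_ang_gt0.
have xz0 : 0 < cos (q * mdist x z) by exact: cos_ang_gt0.
have := cos_le1 (q * mdist x p); have := cos_le1 (q * mdist x z).
rewrite -/q -/l; move: xp0 xz0.
set A := cos (q * mdist x p); set B := cos (q * mdist x z).
set D := cos (q * mdist x (c s)) => A0 B0 B1 A1 DB H.
have pi0 := pi_gt0 R; have qlpi : q * l < pi / 2 by exact: X_small.
have qs : 0 < q * s by rewrite mulr_gt0.
have qsl : q * s <= q * l by rewrite ler_pM2l.
(* Half-difference and mean of the angles [q * l] and [q * (l - s)], for the sum-to-product
   formula. *)
pose t := q * s / 2; pose v := q * l - t.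
have st : 0 < sin t by apply: sin_gt0_pihalf; rewrite /t; lra.
have sl0 : 0 < sin (q * l) by apply: sin_gt0_pi; lra.
have {DB} H1 : A * cos t <= B * cos v.
  have E1 : sin (q * l) = sin v * cos t + cos v * sin t.
    by rewrite -sinD /v subrK.
  have E2 : sin (q * (l - s)) = sin v * cos t - cos v * sin t.
    by rewrite -sinB; congr sin; rewrite /v /t; field.
  have E3 : sin (q * s) = 2 * sin t * cos t.
    have -> : q * s = t + t by rewrite /t; field.
    by rewrite sinD; ring.
  suff : A * cos t * sin t <= B * cos v * sin t by rewrite ler_pM2r.
  have : B * sin (q * (l - s)) + A * sin (q * s) <= B * sin (q * l).
    by apply: le_trans H _; rewrite ler_pM2r.
  by rewrite E1 E2 E3; nra.
have : cos v - cos (q * l) <= t.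
  have vl : v <= q * l by rewrite /v /t; lra.
  have := cos_lipschitz vl; rewrite /v; lra.
have : 1 - cos t <= t.
  have t0 : 0 <= t by rewrite /t; lra.
  by have := cos_lipschitz t0; rewrite cos0 subr0.
have : 2 * t <= e by rewrite /t; lra.
have ct1 := cos_le1 t.
(* [A - B * cl] splits into [A * (1 - ct)], [A * ct - B * cv] and [B * (cv - cl)], bounded by [t],
   [0] and [t]. *)
move: (cos v) (cos t) (cos (q * l)) H1 ct1 => cv ct cl H1 ct1 te ht hv.
have : A * (1 - ct) <= t by apply: le_trans ht; rewrite ler_piMl// subr_ge0.
have : B * (cv - cl) <= B * t by rewrite ler_pM2l.
have : B * t <= t by rewrite ler_piMl// /t; lra.
lra.
Qed.

Lemma cos_ang_near1 (e : R) : 0 < e ->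
  exists2 h, 0 < h & forall a b : X, 1 - cos (ang a b) < h -> mdist a b < e.
Proof.
set q := Num.sqrt k => e0; have pi0 := pi_gt0 R.
have [qe|qe] := leP (pi / 2) (q * e).
  exists 1 => // a b _; rewrite -(@ltr_pM2l _ q)//.
  exact: lt_le_trans (X_small a b) qe.
have qe0 : 0 < q * e by rewrite mulr_gt0.
have qe_itv : q * e \in `[0, pi] by rewrite in_itv/=; lra.
exists (1 - cos (q * e)).
  by rewrite subr_gt0 -[ltRHS]cos0 ltr_cos// in_itv/=; lra.
by move=> a b; rewrite ltrD2l ltrN2 ltr_cos ?ang_itv// ltr_pM2l.
Qed.

Lemma nearest_point_dist (C : set X) (x z p : X) :
  geodesically_convex (@mdist R X) C -> C z -> C p ->
  (forall y, C y -> mdist x z <= mdist x y) -> mdist z p <= mdist x p.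
Proof.
move=> C_convex Cz Cp z_near; rewrite -le_cos_ang.
apply: le_trans (nearest_point_pythagoras C_convex Cz Cp z_near) _.
by rewrite ler_piMl ?cos_le1// ltW// cos_ang_gt0.
Qed.

(** By the previous inequality, [cos (ang z p) * (1 - cos (ang x z))] is at most
    [cos (ang z p) - cos (ang x p)], and cosine is 1-Lipschitz. With a uniform [M > 0], the decrease
    of the distance to [p] controls the displacement from [x] to [z]. *)
Lemma nearest_point_gap (M : R) (C : set X) (x z p : X) :
  (forall a b : X, M <= cos (ang a b)) ->
  geodesically_convex (@mdist R X) C -> C z -> C p ->
  (forall y, C y -> mdist x z <= mdist x y) ->
  M * (1 - cos (ang x z)) <= Num.sqrt k * (mdist x p - mdist z p).
Proof.
move=> M_le C_convex Cz Cp z_near.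
have := nearest_point_pythagoras C_convex Cz Cp z_near.
have zx : ang z p <= ang x p.
  by rewrite ler_pM2l// (nearest_point_dist C_convex).
have := cos_lipschitz zx.
have : M * (1 - cos (ang x z)) <= cos (ang z p) * (1 - cos (ang x z)).
  by rewrite ler_wpM2r// subr_ge0 cos_le1.
lra.
Qed.

End CAT.

(** * Convergence along ultrafilters *)

Section complete.
Context {R : realType} {X : metricType R}.
Hypothesis X_complete : complete_metric X.

(** Completeness is stated for sequences, so the filter is replaced by centres [y n] of balls of
    radius [1 / (n + 1)]; any two of these balls meet because [F] is proper. *)
Lemma complete_metric_cvg (T : Type) (F : set_system T) (f : T -> X) :
  ProperFilter F ->
  (forall e, 0 < e -> exists y, \forall t \near F, mdist y (f t) < e) ->
  exists l : X, f @ F --> l.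
Proof.
move=> FF f_cauchy.
have /choice[y yP] : forall n : nat, exists y, \forall t \near F,
    mdist y (f t) < n.+1%:R^-1.
  by move=> n; apply: f_cauchy; rewrite invr_gt0.
have y_dist m n : mdist (y m) (y n) < m.+1%:R^-1 + n.+1%:R^-1.
  have [t [tm tn]] := filter_ex (filterI (yP m) (yP n)).
  apply: le_lt_trans (metric_triangle _ (f t) _) _.
  by rewrite ltrD// metric_sym.
have inv_lt e : 0 < e -> \forall n \near \oo, n.+1%:R^-1 < e / 2 :> R.
  by move=> e0; apply: (near_infty_natSinv_lt (PosNum _)); rewrite divr_gt0.
have [l yl] : exists l : X, y @ \oo --> l.
  apply: X_complete; apply: cauchy_exP => e e0.
  have [N _ NP] := inv_lt e e0.
  exists (y N); exists N => // n Nn; rewrite ballEmdist/=.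
  apply: lt_trans (y_dist _ _) _; rewrite (splitr e) ltrD//; apply: NP => //=.
exists l; apply/cvgrPdist_lt => e e0.
near \oo => n.
have ln : mdist l (y n) < e / 2.
  by near: n; apply: cvgr_dist_lt yl _ _; rewrite divr_gt0.
have ne : n.+1%:R^-1 < e / 2 :> R by near: n; exact: inv_lt.
apply: filterS (yP n) => t yt; apply: le_lt_trans (metric_triangle _ (y n) _) _.
by rewrite (splitr e) ltrD// (lt_trans yt).
Unshelve. all: by end_near. Qed.

(** A cluster point of an ultrafilter is a limit: if the preimage of a neighbourhood is not in [U],
    its complement is, contradicting clustering. *)
Lemma ultra_compact_cvg (T : Type) (U : set_system T) (f : T -> X) (K : set X) :
  UltraFilter U -> compact K -> (\forall t \near U, K (f t)) ->
  exists l : X, f @ U --> l.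
Proof.
move=> UU Kc UK; have UP := @ultra_proper _ _ UU.
have [l [_ lcl]] := Kc (f @ U) (fmap_proper_filter f UP) UK.
exists l => N lN; have [//|UN] := in_ultra_setVsetC (f @^-1` N) UU.
by have [y [/= nNy Ny]] := lcl (~` N) N UN lN.
Qed.

(* The set of parameters [t] at which [z t] converges along [U] is closed by
   completeness and open by local compactness. *)
Lemma locally_compact_path_cvg (T : Type) (U : set_system T) (C : set X)
    (z : R -> T -> X) (D : R) :
  UltraFilter U -> closed C -> locally_compact C -> 0 < D ->
  (forall t i, 0 <= t <= 1 -> C (z t i)) ->
  (forall s t i, 0 <= s <= 1 -> 0 <= t <= 1 ->
     mdist (z s i) (z t i) <= D * `|s - t|) ->
  (exists l : X, z 0 @ U --> l) -> exists l : X, z 1 @ U --> l.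
Proof.
move=> UU C_closed C_lcpt D0 zC zD z0; have UP := @ultra_proper _ _ UU.
pose E := [set t : R | 0 <= t <= 1 /\ exists l : X, z t @ U --> l].
have E0 : E 0 by split; rewrite ?lexx ?ler01.
have E_sup : has_sup E by split; [exists 0|exists 1 => t [/andP[]]].
pose s := sup E.
have s01 : 0 <= s <= 1.
  apply/andP; split; first by apply: ub_le_sup; [case: E_sup|].
  by apply: ge_sup; [exists 0|move=> t [/andP[]]].
have [l zl] : exists l : X, z s @ U --> l.
  apply: complete_metric_cvg => e e0.
  (* Parameters within [e / (2 * D)] move every [z _ i] by at most [e / 2], so the limit at a nearby
     [t] in [E] serves as approximate limit at [s]. *)
  have eD : 0 < e / (2 * D) by rewrite divr_gt0// mulr_gt0.
  have [t [t01 [l zl]] st] := sup_adherent eD E_sup.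
  have ts : t <= s by apply: ub_le_sup; [case: E_sup|split => //; exists l].
  exists l; have e2 : 0 < e / 2 by rewrite divr_gt0.
  apply: filterS (cvgr_dist_lt zl e2) => i li.
  apply: le_lt_trans (metric_triangle _ (z t i) _) _.
  rewrite (splitr e) ltr_leD//; apply: le_trans (zD _ _ _ t01 s01) _.
  rewrite -ler_pdivlMl// ler_norml.
  have -> : D^-1 * (e / 2) = e / (2 * D) by field; rewrite gt_eqF.
  by move: st; rewrite -/s => st; lra.
have Cl : C l.
  by apply: closed_cvg zl => //; apply: nearW => i; exact: zC.
(* If [s < 1], a compact [K] contains the points of [C] near [l], hence [z t i] for [U]-most [i] at
   some [t] beyond [s]; then [t] is in [E], contradicting the supremum. *)
have [s1|s1] := leP 1 s; first by have <- : s = 1; [lra|exists l].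
have [K CK [Kc _]] := C_lcpt l Cl.
have [d /= d0 dK] : exists2 d, 0 < d & forall y, mdist l y < d -> C y -> K y.
  by move: CK; rewrite /within /= -filter_from_mdist_nbhs => -[d d0 dP]; exists d.
pose t := Num.min 1 (s + d / (2 * D)).
have dD : 0 < d / (2 * D) by rewrite divr_gt0// mulr_gt0.
have st : s < t by rewrite lt_min s1 ltrDl.
have t01 : 0 <= t <= 1 by rewrite ge_min lexx/=; lra.
suff /(ub_le_sup E_sup.2) : E t by rewrite -/s leNgt st.
split=> //; apply: ultra_compact_cvg Kc _.
have d2 : 0 < d / 2 by rewrite divr_gt0.
apply: filterS (cvgr_dist_lt zl d2) => i li; apply: dK; last exact: zC.
apply: le_lt_trans (metric_triangle _ (z s i) _) _.
rewrite (splitr d) ltr_leD//; apply: le_trans (zD _ _ _ s01 t01) _.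
rewrite -ler_pdivlMl// ler_norml.
have -> : D^-1 * (d / 2) = d / (2 * D) by field; rewrite gt_eqF.
have : t <= s + d / (2 * D) by rewrite ge_min lexx orbT.
lra.
Qed.

(** Subtracting the partial sums of [eps] makes the sequence nonincreasing, and it stays above minus
    the total sum. *)
Lemma quasi_fejer_cvg (a eps : nat -> R) :
  (forall n, 0 <= a n) -> (forall n, 0 <= eps n) -> cvgn (series eps) ->
  (forall n, a n.+1 <= a n + eps n) -> cvgn a.
Proof.
move=> a0 eps0 eps_cvg a_le.
have -> : a = (a \- series eps) \+ series eps by apply/funext => n /=; rewrite subrK.
apply: is_cvgD => //; apply: nonincreasing_is_cvgn.
  by apply/nonincreasing_seqP => n /=; have := a_le n; rewrite seriesSr; lra.
exists (- limn (series eps)) => _ [n _ <-] /=.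
have : series eps n <= limn (series eps).
  apply: nondecreasing_cvgn_le => //; apply/nondecreasing_seqP => m.
  by rewrite seriesSr lerDl.
have := a0 n; lra.
Qed.

End complete.

(** * Cyclic projections *)

Lemma diam_bound (R : realType) (X : metricType R) (d : R) :
  0 <= d -> (diam X < d%:E)%E -> exists2 D, D < d & forall x y : X, mdist x y <= D.
Proof.
move=> d0 Xd; have le_diam (x y : X) : ((mdist x y)%:E <= diam X)%E.
  by apply: ereal_sup_ubound; exists (x, y).
move: (diam X) Xd le_diam => [D||] //; first by exists D.
(* Diameter [-oo] means that [X] is empty, so any bound below [d] will do. *)
move=> _ le_diam; exists (d - 1); first by rewrite ltrBlDr ltrDl.
by move=> x y; have := le_diam x y.
Qed.

Section cyclic_projections.
Context {R : realType} {X : metricType R} (k : R).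
Hypotheses (k_gt0 : 0 < k) (X_complete : complete_metric X) (X_CAT : CAT k X).
Hypothesis X_diam : (diam X < (pi / (2 * Num.sqrt k))%:E)%E.
Context (r : nat) (r_gt0 : (0 < r)%N) (C : 'I_r -> set X).
Hypothesis C_neq0 : forall i, C i !=set0.
Hypothesis C_closed : forall i, closed (C i).
Hypothesis C_convex : forall i, geodesically_convex (@mdist R X) (C i).
Context (eps : nat -> R) (x : nat -> X).
Hypotheses (eps_ge0 : forall n, 0 <= eps n) (eps_summable : cvgn (series eps)).
Let P i := metric_projection (C i).
Let idx n := Ordinal (ltn_pmod n r_gt0).
Hypothesis x_step : forall n, mdist (x n.+1) (P (idx n) (x n)) <= eps n.

Let sqrtk_gt0 : 0 < Num.sqrt k. Proof. by rewrite sqrtr_gt0. Qed.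

(** The strict diameter bound leaves a uniform margin below [pi / 2], hence a positive lower bound
    for all cosines of distances. *)
Let X_small_unif : exists2 D, Num.sqrt k * D < pi / 2 &
  forall a b : X, Num.sqrt k * mdist a b <= Num.sqrt k * D.
Proof.
have [|D Dk D_le] := diam_bound _ X_diam.
  by rewrite divr_ge0 ?pi_ge0// mulr_ge0// ltW.
exists D => [|a b]; last by rewrite ler_pM2l.
by move: Dk; rewrite invfM mulrA ltr_pdivlMr// mulrC.
Qed.

Let X_small (a b : X) : Num.sqrt k * mdist a b < pi / 2.
Proof. by have [D Dpi /(_ a b) /le_lt_trans] := X_small_unif; apply. Qed.

Let P_spec i y :
  C i (P i y) /\ forall c, C i c -> mdist y (P i y) <= mdist y c.
Proof. exact: (metric_projectionP k_gt0 X_CAT X_small X_complete). Qed.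

Let eps_cvg0 : eps @ \oo --> 0.
Proof. exact: cvg_series_cvg_0. Qed.

Lemma cyclic_projection_quasi_fejer p n : (\bigcap_i C i) p ->
  mdist (x n.+1) p <= mdist (x n) p + eps n.
Proof.
move=> Cp; have [CP P_near] := P_spec (idx n) (x n).
have := nearest_point_dist k_gt0 X_CAT X_small (@C_convex _) CP (Cp _ I) P_near.
have := x_step n; have := metric_triangle (x n.+1) (P (idx n) (x n)) p; lra.
Qed.

Lemma cyclic_projection_dist_cvg p : (\bigcap_i C i) p ->
  cvgn (fun n => mdist (x n) p).
Proof.
move=> Cp; apply: (@quasi_fejer_cvg _ _ eps) => // n; first exact: mdist_ge0.
exact: cyclic_projection_quasi_fejer.
Qed.

Hypothesis C_meet : \bigcap_i C i !=set0.

Lemma cyclic_projection_gap0 (e : R) : 0 < e ->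
  \forall n \near \oo, mdist (x n) (P (idx n) (x n)) < e.
Proof.
move=> e0; have [p Cp] := C_meet.
have [D Dpi D_le] := X_small_unif.
have pi0 := pi_gt0 R.
have D0 : 0 <= Num.sqrt k * D.
  by apply: le_trans (D_le p p); rewrite mdistxx mulr0.
pose M := cos (Num.sqrt k * D).
have M0 : 0 < M by apply: cos_gt0_pihalf; lra.
have M_le (a b : X) : M <= cos (Num.sqrt k * mdist a b).
  have D_itv : Num.sqrt k * D \in `[0, pi] by rewrite in_itv/=; lra.
  have ab_itv := ang_itv X_small a b.
  by rewrite leNgt (ltr_cos D_itv ab_itv) -leNgt.
have [h h0 hP] := cos_ang_near1 k_gt0 X_small e0.
(* Upper bound for [1 - cos] of the gap, obtained from [nearest_point_gap] by trading the projection
   for [x n.+1] at cost [eps n]. It tends to 0 because the distances to [p] converge. *)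
pose g n := M^-1 * (Num.sqrt k * (mdist (x n) p - mdist (x n.+1) p + eps n)).
have g0 : g @ \oo --> 0.
  have /cvg_ex[L xL] := cyclic_projection_dist_cvg Cp.
  have xL' : (fun n => mdist (x n.+1) p) @ \oo --> L.
    by have := xL; rewrite -(cvg_shiftS (fun n => mdist (x n) p)).
  have -> : 0 = M^-1 * (Num.sqrt k * (L - L + 0)) by rewrite subrr addr0 !mulr0.
  apply: cvgMr; apply: cvgMr; apply: cvgD => //; exact: cvgB.
near=> n; have gh : g n < h by near: n; exact: (cvgr_lt 0 g0).
apply: hP; apply: le_lt_trans gh.
have [CP P_near] := P_spec (idx n) (x n).
have := nearest_point_gap k_gt0 X_CAT X_small M_le (@C_convex _) CP (Cp _ I) P_near.
rewrite /g ler_pdivlMl//; move/le_trans; apply; rewrite ler_pM2l//.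
have := x_step n; have := metric_triangle (x n.+1) (P (idx n) (x n)) p; lra.
Unshelve. all: by end_near. Qed.

Lemma cyclic_projection_step0 (e : R) : 0 < e ->
  \forall n \near \oo, mdist (x n) (x n.+1) < e.
Proof.
move=> e0; have e2 : 0 < e / 2 by rewrite divr_gt0.
near=> n.
have gap : mdist (x n) (P (idx n) (x n)) < e / 2.
  by near: n; exact: cyclic_projection_gap0.
have epsn : eps n < e / 2.
  by near: n; exact: (cvgr_lt 0 eps_cvg0).
apply: le_lt_trans (metric_triangle _ (P (idx n) (x n)) _) _.
have := x_step n; rewrite (metric_sym (x n.+1)); lra.
Unshelve. all: by end_near. Qed.

(** Within fewer than [r] small steps the turn of [i] comes, and the projection of that iterate onto
    [C i] is a competitor for the nearest point to [x n]. *)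
Lemma cyclic_projection_near i (e : R) : 0 < e ->
  \forall n \near \oo, mdist (x n) (P i (x n)) < e.
Proof.
move=> e0; have r0 : 0 < r.+1%:R :> R by [].
have er : 0 < e / r.+1%:R by rewrite divr_gt0.
have [N1 _ N1P] := cyclic_projection_step0 er.
have [N2 _ N2P] := cyclic_projection_gap0 er.
have x_dist n j : (N1 <= n)%N -> mdist (x n) (x (n + j)%N) <= j%:R * (e / r.+1%:R).
  move=> Nn; elim: j => [|j IH]; first by rewrite addn0 mdistxx mul0r.
  apply: le_trans (metric_triangle _ (x (n + j)%N) _) _.
  rewrite -natr1 mulrDl mul1r lerD// addnS ltW//; apply: N1P => /=.
  exact: leq_trans Nn (leq_addr _ _).
exists (maxn N1 N2) => // n /=; rewrite geq_max => /andP[N1n N2n].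
(* The waiting time until index [i]: [j] steps and one gap use [j + 1 <= r] of the [r + 1] shares of
   [e]. *)
pose j := ((i + (r - n %% r)) %% r)%N.
have jr : (j < r)%N by rewrite ltn_mod.
have ij : idx (n + j)%N = i.
  apply: val_inj => /=; rewrite /j modnDmr -modnDml addnCA subnKC; last first.
    by rewrite ltnW// ltn_mod.
  by rewrite modnDr modn_small.
have [CP _] := P_spec i (x (n + j)%N).
have [_ /(_ _ CP)/le_lt_trans] := P_spec i (x n); apply.
apply: le_lt_trans (metric_triangle _ (x (n + j)%N) _) _.
have gap : mdist (x (n + j)%N) (P i (x (n + j)%N)) < e / r.+1%:R.
  rewrite -[X in P X]ij; apply: N2P => /=; exact: leq_trans N2n (leq_addr _ _).
apply: lt_le_trans (_ : j%:R * (e / r.+1%:R) + e / r.+1%:R <= _).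
  by rewrite ler_ltD// x_dist.
have -> : j%:R * (e / r.+1%:R) + e / r.+1%:R = j.+1%:R * (e / r.+1%:R).
  by rewrite -[j.+1%:R]natr1 mulrDl mul1r.
by rewrite mulrCA ler_piMr ?ltW// ltr_pdivrMr// mul1r ltr_nat ltnS.
Qed.

Lemma cyclic_projection_cluster i0 : locally_compact (C i0) ->
  exists (U : set_system nat) (l : X),
    [/\ UltraFilter U, \oo `<=` U & x @ U --> l].
Proof.
move=> C_lcpt; have [p Cp] := C_meet.
have [U [UU ooU]] := ultraFilterLemma eventually_filter.
have UP := @ultra_proper _ _ UU.
pose y n := P i0 (x n).
have /choice[c cP] : forall n, exists c,
    geodesic_path (@mdist R X) p (y n) (mdist p (y n)) c.
  by move=> n; exact: (CAT_geodesic X_CAT).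
(* The geodesics have different lengths, so they are rescaled to the unit interval; the diameter
   bound [D] is a common Lipschitz constant. *)
pose z (t : R) n := c n (t * mdist p (y n)).
have t_itv t n : 0 <= t <= 1 -> t * mdist p (y n) \in `[0, mdist p (y n)].
  move=> /andP[t0 t1]; rewrite in_itv/= mulr_ge0 ?mdist_ge0//=.
  by rewrite ler_piMl// mdist_ge0.
pose D := pi / 2 / Num.sqrt k.
have D0 : 0 < D by rewrite !divr_gt0// pi_gt0.
have D_le (a b : X) : mdist a b <= D.
  by rewrite /D ler_pdivlMr// mulrC ltW// X_small.
have [l zl] : exists l : X, z 1 @ U --> l.
  apply: (locally_compact_path_cvg X_complete UU (@C_closed i0) C_lcpt D0).
  - move=> t n t01; apply: (C_convex (Cp i0 I) (P_spec i0 (x n)).1).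
      by exists (mdist p (y n)), (c n); split; [exact: cP|reflexivity].
    by exists (t * mdist p (y n)) => //; exact: t_itv.
  - move=> s t n s01 t01; have [_ _ _ ->] := cP n; [|exact: t_itv..].
    rewrite -mulrBl normrM (ger0_norm (mdist_ge0 _ _)) mulrC.
    by rewrite ler_wpM2r.
  - exists p; have -> : z 0 = fun=> p; last exact: cvg_cst.
    by apply/funext => n; rewrite /z mul0r; case: (cP n).
have yl : y @ U --> l.
  suff -> : y = z 1 by [].
  by apply/funext => n; rewrite /z mul1r; case: (cP n).
exists U, l; split => //; apply/cvgrPdist_lt => e e0.
have e2 : 0 < e / 2 by rewrite divr_gt0.
have near_proj := ooU _ (cyclic_projection_near i0 e2).
apply: filterS2 (cvgr_dist_lt yl e2) near_proj => n ly xy.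
apply: le_lt_trans (metric_triangle _ (y n) _) _.
by rewrite (splitr e) ltrD// metric_sym.
Qed.

Lemma cyclic_projection_cvg : (exists i, locally_compact (C i)) ->
  exists l : X, (\bigcap_i C i) l /\ x @ \oo --> l.
Proof.
move=> [i0 /cyclic_projection_cluster[U [l [UU ooU xl]]]].
have UP := @ultra_proper _ _ UU.
have Cl : (\bigcap_i C i) l.
  move=> i _; have : (fun n => P i (x n)) @ U --> l.
    apply/cvgrPdist_lt => e e0; have e2 : 0 < e / 2 by rewrite divr_gt0.
    have near_proj := ooU _ (cyclic_projection_near i e2).
    apply: filterS2 (cvgr_dist_lt xl e2) near_proj => n lx xP.
    apply: le_lt_trans (metric_triangle _ (x n) _) _.
    by rewrite (splitr e) ltrD.
  apply: closed_cvg => //; apply: nearW => n; exact: (P_spec i (x n)).1.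
exists l; split=> //.
(* Since [l] is in the intersection, its distance to [x n] has a limit along [\oo]; [U] refines
   [\oo], so this limit is the one along [U], namely 0. *)
have /cvg_ex[L xL] := cyclic_projection_dist_cvg Cl.
have xU : (fun n => mdist (x n) l) @ U --> 0.
  apply/cvgr0Pnorm_lt => e e0; apply: filterS (cvgr_dist_lt xl e0) => n.
  by rewrite ger0_norm ?mdist_ge0// metric_sym.
have xLU : (fun n => mdist (x n) l) @ U --> L.
  by move=> A LA; apply: ooU; exact: xL.
have L0 : L = 0 by exact: (cvg_unique _ xLU xU).
apply/cvgrPdist_lt => e e0.
rewrite L0 in xL; near=> n; rewrite metric_sym.
by near: n; exact: (cvgr_lt 0 xL).
Unshelve. all: by end_near. Qed.

End cyclic_projections.

Theorem proposition4p3 (R : realType) (k : R) (X : metricType R)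
  (k_gt0 : 0 < k)
  (X_complete : complete_metric X)
  (X_CAT : CAT k X)
  (X_diam : (diam X < (pi / (2 * Num.sqrt k))%:E)%E)
  (r : nat) (r_gt0 : (0 < r)%N)
  (C : 'I_r -> set X)
  (C_neq0 : forall i, C i !=set0)
  (C_closed : forall i, closed (C i))
  (C_convex : forall i, geodesically_convex (@mdist R X) (C i))
  (C_meet : \bigcap_i C i !=set0)
  (C_lcpt : exists i, locally_compact (C i))
  (eps : nat -> R)
  (eps_ge0 : forall n, 0 <= eps n)
  (eps_summable : cvgn (series eps))
  (x0 : X) (x : nat -> X)
  (x_start : x 0%N = x0)
  (x_step : forall n, mdist (x n.+1)
     (metric_projection (C (Ordinal (ltn_pmod n r_gt0))) (x n)) <= eps n) :
  exists l : X, (\bigcap_i C i) l /\ x @ \oo --> l.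
Proof. exact: (cyclic_projection_cvg k_gt0). Qed.
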